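(* Let $G$ be a graph of order $n\geq 2$. (a) For every $k\geq 1$, $\gamma^r_k(G)=1$ if and only if $G\in\{P_2,P_3,\dots,P_{k+1}\}$. (b) Suppose $G$ is connected with $n\geq 4$. Then $\gamma^r_2(G)=n-2$ if and only if $G$ is $P_4$, or $K_{s,t}$ ($s,t\geq1$), or $K_s+\overline{K}_t$ ($s\geq 1,t\geq 2$), or $K_s+(K_1\cup K_t)$ ($s,t\geq 1$). For every $k\geq 3$, $\gamma^r_k(G)=n-2$ if and only if $G$ is $K_{s,t}$ ($s,t\geq1$), or $K_s+\overline{K}_t$ ($s\geq 1,t\geq 2$), or $K_s+(K_1\cup K_t)$ ($s,t\geq 1$). (c) Suppose $G$ is connected. For every $k\geq 2$, $\gamma^r_k(G)=n-1$ if and only if $G\cong K_n$.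
   Context: $P_m$ is the path on $m$ vertices, $K_m$ the complete graph, $K_{s,t}$ the complete bipartite graph, $\overline{H}$ the complement of $H$, $H_1\cup H_2$ the disjoint union, and $H_1+H_2$ the join (disjoint union plus all edges between $V(H_1)$ and $V(H_2)$). For a graph $G=(V,E)$ and $k\geq 1$, a set $D\subseteq V$ is distance $k$-dominating if every $v\in V\setminus D$ is at distance at most $k$ from some vertex of $D$. An ordered set $W=\{w_1,\dots,w_r\}$ is a resolving set if for all distinct $u,v\in V\setminus W$ the distance vectors $(d_G(u,w_i))_i$ and $(d_G(v,w_i))_i$ differ. $\gamma^r_k(G)$ is the minimum cardinality of a set that is both resolving and distance $k$-dominating. For disconnected graphs, the distance between vertices in different components is $\infty$. *)

(* Defs.v *)
From mathcomp Require Import all_boot.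

Set Implicit Arguments.
Unset Strict Implicit.
Unset Printing Implicit Defensive.

Record sgraph := SGraph {
  vertex :> finType;
  adj : rel vertex;
  adj_sym : symmetric adj;
  adj_irr : irreflexive adj
}.

Definition iso (G H : sgraph) : Prop :=
  exists2 f : G -> H, bijective f & forall x y, adj (f x) (f y) = adj x y.

Definition connected (G : sgraph) : Prop := forall x y : G, connect (@adj G) x y.

Section Distance.
Variable G : sgraph.

Definition walk (x y : G) (l : nat) : bool :=
  [exists p : l.-tuple G, path (@adj G) x p && (last x p == y)].

Lemma connect_walk x y : connect (@adj G) x y -> exists l, walk x y l.
Proof.
case/connectP=> p px ->; exists (size p).
by apply/existsP; exists (in_tuple p); rewrite px eqxx.
Qed.

(* None stands for the infinite distance between different components *)
Definition dist (x y : G) : option nat :=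
  match @idP (connect (@adj G) x y) with
  | ReflectT xy => Some (ex_minn (connect_walk xy))
  | ReflectF _ => None
  end.

Definition within (k : nat) (x y : G) : bool :=
  if dist x y is Some d then d <= k else false.

Definition distance_dominating (k : nat) (D : {set G}) : bool :=
  [forall v, (v \notin D) ==> [exists w in D, within k v w]].

(* The order chosen on W is that of enum; the notion does not depend on it. *)
Definition distance_vector (W : {set G}) (v : G) : seq (option nat) :=
  [seq dist v w | w <- enum W].

Definition resolving (W : {set G}) : bool :=
  [forall u, forall v, [&& u \notin W, v \notin W & u != v] ==>
    (distance_vector W u != distance_vector W v)].

End Distance.

(* The whole vertex set is resolving and distance k-dominating, so the minimum
   is taken over a nonempty family. *)
Definition gamma_r (k : nat) (G : sgraph) : nat :=
  #|[arg min_(D < [set: G] | resolving D && distance_dominating k D) #|D| ]|.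

Section Families.

Definition path_rel m : rel 'I_m := fun i j => (i.+1 == j :> nat) || (j.+1 == i :> nat).
Lemma path_rel_sym m : symmetric (@path_rel m).
Proof. by move=> i j; rewrite /path_rel orbC. Qed.
Lemma path_rel_irr m : irreflexive (@path_rel m).
Proof. by move=> i; rewrite /path_rel orbb gtn_eqF. Qed.
Definition path_graph m := SGraph (@path_rel_sym m) (@path_rel_irr m).

Definition complete_rel m : rel 'I_m := fun i j => i != j.
Lemma complete_rel_sym m : symmetric (@complete_rel m).
Proof. by move=> i j; rewrite /complete_rel eq_sym. Qed.
Lemma complete_rel_irr m : irreflexive (@complete_rel m).
Proof. by move=> i; rewrite /complete_rel eqxx. Qed.
Definition complete m := SGraph (@complete_rel_sym m) (@complete_rel_irr m).

Definition bipartite_rel s t : rel ('I_s + 'I_t) := fun x y =>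
  match x, y with inl _, inr _ | inr _, inl _ => true | _, _ => false end.
Lemma bipartite_rel_sym s t : symmetric (@bipartite_rel s t).
Proof. by move=> [i|i] [j|j]. Qed.
Lemma bipartite_rel_irr s t : irreflexive (@bipartite_rel s t).
Proof. by move=> [i|i]. Qed.
Definition complete_bipartite s t :=
  SGraph (@bipartite_rel_sym s t) (@bipartite_rel_irr s t).

Variables G H : sgraph.

Definition compl_rel : rel G := fun x y => (x != y) && ~~ adj x y.
Lemma compl_rel_sym : symmetric compl_rel.
Proof. by move=> x y; rewrite /compl_rel eq_sym adj_sym. Qed.
Lemma compl_rel_irr : irreflexive compl_rel.
Proof. by move=> x; rewrite /compl_rel eqxx. Qed.
Definition compl_graph := SGraph compl_rel_sym compl_rel_irr.

Definition union_rel : rel (G + H) := fun x y =>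
  match x, y with
  | inl a, inl b => adj a b
  | inr a, inr b => adj a b
  | _, _ => false
  end.
Lemma union_rel_sym : symmetric union_rel.
Proof. by move=> [a|a] [b|b] //=; rewrite adj_sym. Qed.
Lemma union_rel_irr : irreflexive union_rel.
Proof. by move=> [a|a] /=; rewrite adj_irr. Qed.
Definition union_graph := SGraph union_rel_sym union_rel_irr.

Definition join_rel : rel (G + H) := fun x y =>
  match x, y with
  | inl a, inl b => adj a b
  | inr a, inr b => adj a b
  | _, _ => true
  end.
Lemma join_rel_sym : symmetric join_rel.
Proof. by move=> [a|a] [b|b] //=; rewrite adj_sym. Qed.
Lemma join_rel_irr : irreflexive join_rel.
Proof. by move=> [a|a] /=; rewrite adj_irr. Qed.
Definition join_graph := SGraph join_rel_sym join_rel_irr.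

End Families.

(* Main.v *)
(** If a single vertex w resolves G, then the distances to w are pairwise
    distinct and fill an initial segment of the integers, so G is a path with
    end w.

    Parts (b) and (c) depend on how many vertices can be deleted from V so that
    the remaining ones resolve and dominate. In a connected non-complete graph
    an induced path x z y allows the deletion of {y, z}, and a geodesic on four
    vertices allows the deletion of three vertices as soon as n >= 5. So let the
    diameter be at most 2. Distances are then determined by adjacency, and no
    three vertices are deletable iff no two vertices u, v separate three others
    by adjacency. This is a condition on 5-vertex induced subgraphs, and it is
    invariant under complementation. In the complement H, every edge has a
    common non-neighbour, since G has diameter at most 2. If H contains an
    induced path x y z, then all edges of H are incident to y, and G is
    K_s + (K_1 u K_t). Otherwise H is a disjoint union of cliques: either
    exactly two cliques, and G is complete bipartite, or one clique and isolated
    vertices, and G is K_s joined to an independent set. *)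

Require Import Defs.
From mathcomp Require Import all_boot.
From mathcomp Require Import zify.

Set Implicit Arguments.
Unset Strict Implicit.
Unset Printing Implicit Defensive.

(** * Walks, distances, resolving and dominating sets *)

Section Distance.
Variable G : sgraph.
Implicit Types x y z u v w a b c : G.

Lemma walkP x y l :
  reflect (exists p, [/\ size p = l, path (@adj G) x p & last x p = y]) (walk x y l).
Proof.
apply: (iffP existsP) => [[p /andP[px /eqP lp]]|[p [<- px <-]]].
  by exists p; rewrite size_tuple.
by exists (in_tuple p); rewrite px eqxx.
Qed.

Lemma walk0 x y : walk x y 0 = (x == y).
Proof.
by apply/walkP/eqP => [[p [/size0nil-> _ <-]]|->] //; exists [::].
Qed.

Lemma walkS x y l : reflect (exists2 z, adj x z & walk z y l) (walk x y l.+1).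
Proof.
apply: (iffP (walkP _ _ _)) => [[[|z p] []//= [sp] /andP[xz pz] lp]|[z xz /walkP[p [sp pz lp]]]].
  by exists z => //; apply/walkP; exists p.
by exists (z :: p); rewrite /= sp xz.
Qed.

Lemma walk1 x y : walk x y 1 = adj x y.
Proof.
apply/walkS/idP => [[z xz]|xy]; first by rewrite walk0 => /eqP <-.
by exists y; rewrite ?walk0.
Qed.

Lemma walk_cat x y z l m : walk x y l -> walk y z m -> walk x z (l + m).
Proof.
move=> /walkP[p [sp px lp]] /walkP[q [sq qy lq]]; apply/walkP.
by exists (p ++ q); rewrite size_cat cat_path last_cat lp sp sq px.
Qed.

Lemma walk_sym x y l : walk x y l -> walk y x l.
Proof.
elim: l x => [|l IHl] x; first by rewrite !walk0 eq_sym.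
case/walkS => z xz /IHl yz; rewrite -addn1; apply: walk_cat yz _.
by rewrite walk1 adj_sym.
Qed.

Lemma walk_connect x y l : walk x y l -> connect (@adj G) x y.
Proof. by case/walkP => p [_ px <-]; apply/connectP; exists p. Qed.

Lemma dist_Some x y d :
  dist x y = Some d <-> walk x y d /\ forall l, walk x y l -> d <= l.
Proof.
rewrite /dist; case: {-}_ / idP => [xy|nxy].
  case: ex_minnP => m wm mmin; split=> [[<-]//|[wd dmin]].
  by congr Some; apply/eqP; rewrite eqn_leq mmin // dmin.
by split=> // -[/walk_connect].
Qed.

Lemma connected_dist x y : connected G -> exists d, dist x y = Some d.
Proof.
move=> /(_ x y)/connect_walk Gxy; case: (ex_minnP Gxy) => d wd dmin.
by exists d; apply/dist_Some.
Qed.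

Lemma dist_sym x y : dist x y = dist y x.
Proof.
have sub u v d : dist u v = Some d -> dist v u = Some d.
  by move=> /dist_Some[w wmin]; apply/dist_Some; split=> [|l /walk_sym/wmin//]; apply: walk_sym.
case xy: (dist x y) => [d|]; first by rewrite (sub _ _ _ xy).
by case yx: (dist y x) => [d|//]; rewrite (sub _ _ _ yx) in xy.
Qed.

Lemma dist_Some0 x y : dist x y = Some 0 <-> x = y.
Proof.
split=> [/dist_Some[]|->]; first by rewrite walk0 => /eqP.
by apply/dist_Some; rewrite walk0.
Qed.

Lemma dist_Some1 x y : dist x y = Some 1 <-> adj x y.
Proof.
split=> [/dist_Some[]|xy]; first by rewrite walk1.
apply/dist_Some; rewrite walk1; split=> // -[|//]; rewrite walk0 => /eqP yx.
by rewrite yx adj_irr in xy.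
Qed.

Lemma dist_SomeS {x y d} : dist x y = Some d.+1 ->
  exists2 z, adj x z & dist z y = Some d.
Proof.
move=> /dist_Some[/walkS[z xz wz] dmin]; exists z => //; apply/dist_Some; split=> // l wl.
by rewrite -ltnS; apply: dmin; apply/walkS; exists z.
Qed.

Lemma dist_adj {x z y d e} :
  adj x z -> dist x y = Some d -> dist z y = Some e -> d <= e.+1.
Proof.
by move=> xz /dist_Some[_ dmin] /dist_Some[we _]; apply: dmin; apply/walkS; exists z.
Qed.

Lemma dist_Some2 x y z : x != y -> ~~ adj x y -> adj x z -> adj z y ->
  dist x y = Some 2.
Proof.
move=> xy nadj xz zy; apply/dist_Some; split.
  by apply/walkS; exists z; rewrite ?walk1.
by move=> [|[|//]]; rewrite ?walk0 ?walk1 ?(negPf xy) ?(negPf nadj).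
Qed.

Lemma withinP k x y : reflect (exists2 l, l <= k & walk x y l) (within k x y).
Proof.
rewrite /within; case xy: (dist x y) => [d|].
  move/dist_Some: xy => [wd dmin].
  by apply: (iffP idP) => [dk|[l lk /dmin/leq_trans]]; [exists d|apply].
constructor=> -[l _ /walk_connect/connect_walk Gxy].
case: (ex_minnP Gxy) => d wd dmin.
by rewrite (_ : dist x y = Some d) in xy => //; apply/dist_Some.
Qed.

Lemma within_leq j k x y : j <= k -> within j x y -> within k x y.
Proof.
by move=> jk /withinP[l lj w]; apply/withinP; exists l => //; apply: leq_trans jk.
Qed.

Lemma adj_within k x y : 0 < k -> adj x y -> within k x y.
Proof. by move=> k0 xy; apply/withinP; exists 1; rewrite ?walk1. Qed.

(** At range at most 2 the distance takes one of three values, read off from equality and adjacency.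
    This turns resolvability in diameter 2 into a question about adjacency alone. *)
Lemma within2_dist x y : within 2 x y ->
  dist x y = if x == y then Some 0 else if adj x y then Some 1 else Some 2.
Proof.
rewrite /within; case: eqP => [<- _|nxy]; first exact/dist_Some0.
case: ifP => [/dist_Some1//|nadj]; case xy: (dist x y) => [[|[|[|//]]]|//] _ //.
  by case: nxy; apply/dist_Some0.
by move/dist_Some1: xy; rewrite nadj.
Qed.

(** Two distance vectors differ exactly when some coordinate does, which frees the notion from the
    enumeration order. *)
Lemma resolvingP (D : {set G}) :
  reflect (forall u v, u \notin D -> v \notin D -> u != v ->
             exists2 w, w \in D & dist u w != dist v w) (resolving D).
Proof.
apply: (iffP forallP) => [res u v uD vD uv|res u].
  have /forallP/(_ v) := res u; rewrite uD vD uv /= => /negP neq.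
  apply/exists_inP; case: exists_inP => // noex; case: neq; apply/eqP/eq_in_map => w.
  by rewrite mem_enum => wD; apply/eqP; apply: contraT => ?; case: noex; exists w.
apply/forallP => v; apply/implyP => /and3P[uD vD uv].
have [w wD] := res _ _ uD vD uv; apply: contra => /eqP/eq_in_map eqd.
by rewrite eqd // mem_enum.
Qed.

Lemma dominatingP k (D : {set G}) :
  reflect (forall v, v \notin D -> exists2 w, w \in D & within k v w)
          (distance_dominating k D).
Proof.
by apply: (iffP forallP) => dom v; [move=> /(implyP (dom v))/exists_inP
                                   |apply/implyP => /dom/exists_inP].
Qed.

Lemma gamma_r_ex k : exists D : {set G},
  [/\ resolving D, distance_dominating k D & #|D| = gamma_r k G].
Proof.
rewrite /gamma_r; case: arg_minnP => [|D /andP[res dom] _]; last by exists D.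
apply/andP; split; first by apply/resolvingP => u v; rewrite inE.
by apply/dominatingP => v; rewrite inE.
Qed.

Lemma gamma_r_le {k} {D : {set G}} :
  resolving D -> distance_dominating k D -> gamma_r k G <= #|D|.
Proof.
move=> res dom; rewrite /gamma_r; case: arg_minnP => [|E _]; last first.
  by apply; rewrite res dom.
apply/andP; split; first by apply/resolvingP => u v; rewrite inE.
by apply/dominatingP => v; rewrite inE.
Qed.

Lemma gamma_r_gt0 k : 0 < #|G| -> 0 < gamma_r k G.
Proof.
move=> G0; have [D [_ /dominatingP dom <-]] := gamma_r_ex k.
have /card_gt0P[v _] := G0; apply/card_gt0P.
by have [vD|/dom[w wD _]] := boolP (v \in D); [exists v|exists w].
Qed.

(** Most upper bounds below come from here: a short list [s] of deleted vertices is named, and only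
    these have to be separated and dominated by the rest. *)
Lemma gamma_r_delete k (s : seq G) : uniq s ->
  {in s &, forall u v, u != v -> exists2 w, w \notin s & dist u w != dist v w} ->
  {in s, forall v, exists2 w, w \notin s & within k v w} ->
  gamma_r k G <= #|G| - size s.
Proof.
move=> us res dom; pose D := ~: [set x in s].
have memD x : (x \in D) = (x \notin s) by rewrite !inE.
have <- : #|D| = #|G| - size s.
  by rewrite cardsCs setCK cardsE (card_uniqP us).
apply: gamma_r_le.
  apply/resolvingP => u v; rewrite !memD !negbK => us' vs uv.
  by have [w ws d] := res _ _ us' vs uv; exists w => //; rewrite memD.
apply/dominatingP => v; rewrite !memD negbK => /dom[w ws wi].
by exists w => //; rewrite memD.
Qed.

End Distance.

(** * Part (a): a single resolving and dominating vertex *)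

Section Paths.
Variable G : sgraph.
Implicit Types u v w x y z : G.

Lemma gamma_r_eq1_iso_path k : gamma_r k G = 1 ->
  #|G| <= k.+1 /\ iso G (path_graph #|G|).
Proof.
move=> g1; have [D [/resolvingP res /dominatingP dom]] := gamma_r_ex G k.
rewrite g1 => /eqP/cards1P[w DE].
have dE v : exists2 d, dist v w = Some d & d <= k.
  have [->|vw] := eqVneq v w; first by exists 0 => //; apply/dist_Some0.
  have [|w'] := dom v; first by rewrite DE inE.
  by rewrite DE inE => /eqP ->; rewrite /within; case: (dist v w) => [d|//]; exists d.
(* Domination by [w] makes every distance to [w] finite, so the default 0 never replaces an infinite
   distance. *)
pose f v := odflt 0 (dist v w).
have distf v : dist v w = Some (f v) by rewrite /f; case: (dE v) => d ->.
have fk v : f v <= k by rewrite /f; case: (dE v) => d ->.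
have finj : injective f.
  move=> u v fuv; apply/eqP; apply: contraT => uv.
  have duv : dist u w = dist v w by rewrite !distf fuv.
  have [E|uw] := eqVneq u w.
    subst u; move: duv; rewrite (dist_Some0 w w).2 // => /esym/dist_Some0 vw.
    by rewrite vw eqxx in uv.
  have [E|vw] := eqVneq v w.
    subst v; move: duv; rewrite (dist_Some0 w w).2 // => /dist_Some0 uw'.
    by rewrite uw' eqxx in uv.
  have [||w'] := res u v _ _ uv; rewrite ?DE ?inE //.
  by move=> /eqP ->; rewrite duv eqxx.
have fdown d v j : f v = d -> j <= d -> exists u, f u = j.
  elim: d v => [|d IHd] v fv.
    by rewrite leqn0 => /eqP ->; exists v.
  rewrite leq_eqVlt => /predU1P[->|]; first by exists v.
  have /dist_SomeS[z _ dz] : dist v w = Some d.+1 by rewrite distf fv.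
  by apply: (IHd z); rewrite /f dz.
(* The [(f v).+1] values from 0 to [f v] are all attained, hence at most [#|G|] in number. *)
have flt v : f v < #|G|.
  rewrite -(size_iota 0 (f v).+1) cardE -(size_map f); apply: uniq_leq_size.
    exact: iota_uniq.
  move=> j; rewrite mem_iota ltnS /= => /(fdown _ v _ erefl)[u <-].
  by apply: map_f; rewrite mem_enum.
pose g v : 'I_#|G| := Ordinal (flt v).
have gbij : bijective g.
  by apply: inj_card_bij; rewrite ?card_ord // => u v [/finj].
split.
  have G0 : 0 < #|G| by apply/card_gt0P; exists w.
  have lt : #|G|.-1 < #|G| by rewrite prednK.
  (* The vertex farthest from [w] has [f]-value [#|G|.-1], and domination bounds that value by
     [k]. *)
  case: gbij => h _ gh; have := fk (h (Ordinal lt)).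
  by rewrite -[f _]/(val (g (h (Ordinal lt)))) gh /= -ltnS prednK.
exists g => // x y; rewrite /= /path_rel /=.
(* [a] has a neighbour at distance [f b] from [w]; by injectivity of [f] that neighbour is [b]. *)
have step a b : f a = (f b).+1 -> adj a b.
  move=> fab; have /dist_SomeS[z az dz] : dist a w = Some (f b).+1 by rewrite distf fab.
  by rewrite (finj b z) // /f dz.
apply/idP/idP => [/orP[]/eqP fxy|xy]; [by rewrite adj_sym step| by rewrite step|].
have := dist_adj xy (distf x) (distf y).
rewrite adj_sym in xy; have := dist_adj xy (distf y) (distf x).
have : f x != f y by apply: contraTneq xy => /finj ->; rewrite adj_irr.
lia.
Qed.

(** The distance to the end numbered 0 is the index itself: indices are distinct, so this end
    resolves, and they are at most [m - 1 <= k], so it dominates. *)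
Lemma gamma_r_path k m : 0 < m <= k.+1 -> iso G (path_graph m) ->
  gamma_r k G = 1.
Proof.
move=> /andP[m0 mk] [f fbij fadj].
case: (fbij) => g fg gf; pose w := g (Ordinal m0).
have fw : f w = 0 :> nat by rewrite /w gf.
(* Each edge changes the index by one, so no walk to the end is shorter than the index. *)
have lower x l : walk x w l -> f x <= l.
  elim: l x => [|l IHl] x; first by rewrite walk0 => /eqP ->; rewrite fw.
  case/walkS => z; rewrite -fadj /= /path_rel => xz /IHl; lia.
have distw v : dist v w = Some (nat_of_ord (f v)).
  apply/dist_Some; split; last exact: lower.
  have [d fv] : exists d, nat_of_ord (f v) = d by exists (f v).
  elim: d v fv => [|d IHd] v fv; rewrite fv.
    by rewrite walk0; apply/eqP/(bij_inj fbij)/val_inj; rewrite /= fv fw.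
  have dm : d < m by rewrite -ltnS -fv ltnS ltnW.
  apply/walkS; exists (g (Ordinal dm)).
    by rewrite -fadj gf /= /path_rel /= fv eqxx orbT.
  by have := IHd (g (Ordinal dm)); rewrite gf => /(_ erefl).
apply/eqP; rewrite eqn_leq gamma_r_gt0 ?andbT; last by apply/card_gt0P; exists w.
rewrite -(cards1 w); apply: gamma_r_le.
  apply/resolvingP => u v _ _ uv; exists w; rewrite ?inE //.
  rewrite !distw; apply: contraNneq uv => -[/val_inj/(bij_inj fbij) ->]; exact: eqxx.
apply/dominatingP => v _; exists w; rewrite ?inE // /within distw -ltnS.
exact: leq_trans (ltn_ord _) mk.
Qed.

Lemma iso_card (H : sgraph) : iso G H -> #|G| = #|H|.
Proof. by case=> f /bij_eq_card. Qed.

Lemma gamma_r_eq1P k :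
  2 <= #|G| -> 0 < k ->
  gamma_r k G = 1 <-> exists m, 2 <= m <= k.+1 /\ iso G (path_graph m).
Proof.
move=> G2 k0; split=> [/gamma_r_eq1_iso_path[Gk isoG]|[m [/andP[m2 mk]]]].
  by exists #|G|; rewrite G2.
by apply: gamma_r_path; rewrite mk andbT ltnW.
Qed.

End Paths.

(** * Part (c), and graphs of diameter at least 3 *)

Section Diameter.
Variable G : sgraph.
Implicit Types u v w x y z : G.

Lemma gamma_r_lt k : connected G -> 2 <= #|G| -> 0 < k -> gamma_r k G <= #|G| - 1.
Proof.
move=> cG G2 k0.
have /card_gt0P[v _] : 0 < #|G| by apply: ltnW.
apply: (@gamma_r_delete _ k [:: v]) => // [u u'|u]; rewrite !inE.
  by move=> /eqP -> /eqP ->; rewrite eqxx.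
move=> /eqP -> {u}.
have [u uv] : exists u, u != v.
  have : 0 < #|[set~ v]| by rewrite cardsC1; lia.
  by case/card_gt0P => u; rewrite !inE; exists u.
have [d duv] := connected_dist v u cG.
case: d duv => [/dist_Some0 vu|d /dist_SomeS[z vz _]].
  by rewrite vu eqxx in uv.
exists z; last exact: adj_within.
by rewrite inE; apply: contraTneq vz => ->; rewrite adj_irr.
Qed.

(** Deleting [z] and [y] is harmless: [x] sees them at distances 1 and 2. *)
Lemma gamma_r_induced_path k x z y : 1 < k -> x != y -> ~~ adj x y ->
  adj x z -> adj z y -> gamma_r k G <= #|G| - 2.
Proof.
move=> k2 xy nxy xz zy.
have xDz : x != z by apply: contraTneq xz => ->; rewrite adj_irr.
have zDy : z != y by apply: contraTneq zy => ->; rewrite adj_irr.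
have dy : dist y x = Some 2 by rewrite dist_sym; apply: dist_Some2 xz zy.
have dz : dist z x = Some 1 by apply/dist_Some1; rewrite adj_sym.
have xs : x \notin [:: z; y] by rewrite !inE negb_or xDz.
apply: (@gamma_r_delete _ k [:: z; y]); rewrite /= ?inE ?andbT //.
  move=> u v; rewrite !inE => /orP[]/eqP -> /orP[]/eqP ->; rewrite ?eqxx // => _;
  by exists x; rewrite ?dy ?dz.
move=> v; rewrite !inE => /orP[]/eqP ->; exists x => //.
  by rewrite /within dz ltnW.
by rewrite /within dy.
Qed.

(** The last two edges of a geodesic from [x] to [y] form the induced path. *)
Lemma induced_path_of_nonadj x y d : dist x y = Some d.+2 ->
  exists u v z, [/\ u != v, ~~ adj u v, adj u z & adj z v].
Proof.
elim: d x => [|d IHd] x dxy; have [z xz dz] := dist_SomeS dxy; last exact: IHd dz.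
exists x, y, z; split=> //; last exact/dist_Some1.
  by apply: contraPneq dxy => ->; rewrite (dist_Some0 y y).2.
by apply/negP => /dist_Some1; rewrite dxy.
Qed.

Lemma gamma_r_not_complete k x y : connected G -> 1 < k -> x != y -> ~~ adj x y ->
  gamma_r k G <= #|G| - 2.
Proof.
move=> cG k2 xy nxy; have [[|[|d]] dxy] := connected_dist x y cG.
- by move/dist_Some0: dxy xy => ->; rewrite eqxx.
- by move/dist_Some1: dxy nxy => ->.
have [u [v [z [uv nuv uz zv]]]] := induced_path_of_nonadj dxy.
exact: gamma_r_induced_path uv nuv uz zv.
Qed.

Lemma iso_completeP n : #|G| = n -> iso G (complete n) <-> forall x y, adj x y = (x != y).
Proof.
move=> Gn; split=> [[f fbij fadj] x y|Gadj].
  by rewrite -fadj /= /complete_rel (inj_eq (bij_inj fbij)).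
subst n; exists (@enum_rank G); first exact: enum_rank_bij.
by move=> x y; rewrite /= /complete_rel (inj_eq enum_rank_inj) Gadj.
Qed.

(** A non-adjacent pair already allows two deletions. In a complete graph, two vertices outside [D]
    are at distance 1 from all of [D], so at most one vertex is missing from a resolving set. *)
Lemma gamma_r_completeP k : connected G -> 2 <= #|G| -> 1 < k ->
  gamma_r k G = #|G| - 1 <-> iso G (complete #|G|).
Proof.
move=> cG G2 k2; rewrite iso_completeP //; split=> [gG x y|Gadj].
  apply/idP/idP => [|xy]; first by apply: contraTneq => ->; rewrite adj_irr.
  by apply: contraT => nxy; have := gamma_r_not_complete cG k2 xy nxy; rewrite gG; lia.
apply/eqP; rewrite eqn_leq gamma_r_lt //=; last exact: ltnW.
have [D [/resolvingP res _ <-]] := gamma_r_ex G k.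
rewrite leq_subLR -(cardsC D) addnC leq_add2r leqNgt.
apply/negP => /card_gt1P[u [v [uD vD uv]]]; rewrite !inE in uD vD.
have [w wD] := res u v uD vD uv.
have dw t : t \notin D -> dist t w = Some 1.
  by move=> tD; apply/dist_Some1; rewrite Gadj; apply: contraNneq tD => ->.
by rewrite !dw.
Qed.

(** The inner vertices are recorded through their distances to the two ends. These are the data that
    resolving and dominating use, and they are symmetric under reversal. *)
Definition geodesic3 u0 u1 u2 u3 :=
  [/\ dist u3 u0 = Some 3, dist u2 u0 = Some 2, dist u1 u0 = Some 1,
      dist u1 u3 = Some 2 & dist u2 u3 = Some 1].

Lemma geodesic3_rev u0 u1 u2 u3 : geodesic3 u0 u1 u2 u3 -> geodesic3 u3 u2 u1 u0.
Proof. by case=> d30 d20 d10 d13 d23; split=> //; rewrite dist_sym. Qed.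

Lemma geodesic3_ex x y : connected G -> ~~ within 2 x y ->
  exists u0 u1 u2 u3, geodesic3 u0 u1 u2 u3.
Proof.
move=> cG; have [d dxy] := connected_dist x y cG.
rewrite /within dxy -ltnNge => d3.
(* A geodesic towards [y] passes through a vertex at distance exactly 3. *)
have {x dxy} [x dxy] : exists x, dist x y = Some 3.
  elim: d d3 x dxy => [//|d IHd]; rewrite ltnS leq_eqVlt => /predU1P[<- x|d3 x]; first by exists x.
  by case/dist_SomeS => z _; apply: IHd.
have [u2 xu2 du2] := dist_SomeS dxy; have [u1 u21 du1] := dist_SomeS du2.
have nadj : ~~ adj u1 x.
  by rewrite adj_sym; apply/negP => xu1; have := dist_adj xu1 dxy du1.
exists y, u1, u2, x; split=> //; last by apply/dist_Some1; rewrite adj_sym.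
apply: (@dist_Some2 _ _ _ u2) => //; rewrite 1?adj_sym //.
by apply: contraPneq du1 => ->; rewrite dxy.
Qed.

(** [u0] sees the three deleted vertices at distances 1, 2, 3, so it resolves them, and it dominates
    the first two. For [k = 2] the vertex [u3] is out of its range, whence the extra vertex [w]. *)
Lemma gamma_r_geodesic3 k u0 u1 u2 u3 w : 1 < k -> geodesic3 u0 u1 u2 u3 ->
  w \notin [:: u1; u2; u3] -> within k u3 w -> gamma_r k G <= #|G| - 3.
Proof.
move=> k2 [d3 d2 d1 d13 d23] ws w3.
have neq a b : dist a u0 != dist b u0 -> a != b by apply: contraNneq => ->.
have d0 : dist u0 u0 = Some 0 by apply/dist_Some0.
have u0s : u0 \notin [:: u1; u2; u3].
  by rewrite !inE !negb_or !neq // d0 ?d1 ?d2 ?d3.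
apply: (@gamma_r_delete _ k [:: u1; u2; u3]).
- by rewrite /= !inE !negb_or !neq // ?d1 ?d2 ?d3.
- move=> u v; rewrite !inE => us vs uv; exists u0 => //; move: uv.
  by case/or3P: us => /eqP ->; case/or3P: vs => /eqP ->; rewrite ?eqxx // ?d1 ?d2 ?d3.
move=> v; rewrite !inE => /or3P[] /eqP ->; last by exists w.
  by exists u0; rewrite // /within d1 ltnW.
by exists u0; rewrite // /within d2.
Qed.

Lemma crossing_edge x y (S : pred G) : connected G -> S x -> ~~ S y ->
  exists a b, [/\ S a, ~~ S b & adj a b].
Proof.
move=> /(_ x y)/connectP[p px ->]; elim: p x px => [|z p IHp] x /=; first by move=> _ ->.
move=> /andP[xz pz] Sx; have [Sz|nSz] := boolP (S z); first exact: IHp pz Sz.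
by exists x, z.
Qed.

(* Along a geodesic u0 u1 u2 u3 delete u0 or u3 together with the inner
   vertices; a fifth vertex, taken adjacent to the geodesic, dominates the
   deleted end. *)
Lemma gamma_r_diam3 k x y : connected G -> 1 < k -> 5 <= #|G| -> ~~ within 2 x y ->
  gamma_r k G <= #|G| - 3.
Proof.
move=> cG k2 G5 nxy; have [u0 [u1 [u2 [u3 geo]]]] := geodesic3_ex cG nxy.
pose s := [:: u0; u1; u2; u3].
have [w0 w0s] : exists w0, w0 \notin s.
  apply/existsP; rewrite -negb_forall; apply/negP => /forallP all_s.
  have : #|G| <= size s by rewrite (leq_trans _ (card_size s)) // subset_leq_card //; apply/subsetP.
  by rewrite leqNgt G5.
have [|a [w [aS wS aw]]] := @crossing_edge u0 w0 (mem s) cG _ w0s; first exact: mem_head.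
move: wS; rewrite /= !inE !negb_or => /and4P[w0' w1 w2 w3].
have far a' b : adj a' w -> adj b a' -> within k b w.
  by move=> a'w ba'; apply/withinP; exists 2 => //; apply/walkS; exists a'; rewrite ?walk1.
have geo' := geodesic3_rev geo.
have out : w \notin [:: u1; u2; u3] by rewrite !inE !negb_or w1 w2.
have out' : w \notin [:: u2; u1; u0] by rewrite !inE !negb_or w2 w1.
case: (geo) => d3 d2 /dist_Some1 d1 d13 /dist_Some1 d23.
(* The deleted end is [u0] when [a] is [u0] or [u1], and [u3] otherwise; [w] is then at distance at
   most 2 from it through [a]. *)
move: aS aw; rewrite /= !inE => /or4P[]/eqP -> aw.
- by apply: gamma_r_geodesic3 geo' out' _ => //; apply: adj_within => //; apply: ltnW.
- by apply: gamma_r_geodesic3 geo' out' _ => //; apply: far aw _; rewrite adj_sym.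
- by apply: gamma_r_geodesic3 geo out _ => //; apply: far aw _; rewrite adj_sym.
- by apply: gamma_r_geodesic3 geo out _ => //; apply: adj_within => //; apply: ltnW.
Qed.

(** Once [k] is at least 3, the end [u0] reaches [u3] as well, so [u0] itself serves as the
    dominating [w] and all other vertices can go. *)
Lemma gamma_r_diam3_card4 k x y : connected G -> 2 < k -> #|G| = 4 -> ~~ within 2 x y ->
  gamma_r k G = 1.
Proof.
move=> cG k3 G4 nxy; have [u0 [u1 [u2 [u3 geo]]]] := geodesic3_ex cG nxy.
apply/eqP; rewrite eqn_leq gamma_r_gt0 ?G4 // andbT -[1]/(4 - 3) -G4.
case: (geo) => d3 d2 d1 _ _.
apply: (gamma_r_geodesic3 (ltnW k3) geo (w := u0)); last by rewrite /within d3.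
rewrite !inE !negb_or; apply/and3P.
by split; [move: d1|move: d2|move: d3]; apply: contraPneq => <-; rewrite (dist_Some0 u0 u0).2.
Qed.

End Diameter.

(** * Diameter at most 2: the condition on five vertices *)

Section Twins.

(** Each pair is the trace of one of [a], [b], [c] on [u], [v]; a repeated pair means that [u] and
    [v] fail to separate the triple by adjacency. *)
Definition twin_triples (H : sgraph) := forall a b c u v : H,
  uniq [:: a; b; c; u; v] ->
  ~~ uniq [:: (adj a u, adj a v); (adj b u, adj b v); (adj c u, adj c v)].

Variable G : sgraph.
Implicit Types u v w x y z : G.

(** Between distinct vertices complementation negates every entry of the three pairs, so it
    preserves their coincidences. *)
Lemma twin_triples_compl : twin_triples G -> twin_triples (compl_graph G).
Proof.
move=> T a b c u v U; have := T a b c u v U; apply: contra.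
move: U; rewrite /= !inE !negb_or /compl_rel.
case/and5P=> /and4P[_ _ -> ->] /and3P[_ -> ->] /andP[-> ->] _ _ /=.
by rewrite !xpair_eqE !(can_eq negbK).
Qed.

(** If [u] and [v] separated [a], [b], [c], these three could be deleted: [u] and [v] remain and
    resolve them, and [u] dominates them because all distances are at most 2. *)
Lemma twin_triples_gamma_r k : 1 < k -> 5 <= #|G| -> (forall x y, within 2 x y) ->
  gamma_r k G = #|G| - 2 -> twin_triples G.
Proof.
move=> k2 G5 diam gG a b c u v U; apply/negP => D.
suff : gamma_r k G <= #|G| - 3 by rewrite gG; lia.
move: (U); rewrite -[uniq _]/(uniq ([:: a; b; c] ++ [:: u; v])) cat_uniq.
case/and3P=> abc /hasPn out _.
have us : u \notin [:: a; b; c] by apply: out; rewrite mem_head.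
have vs : v \notin [:: a; b; c] by apply: out; rewrite !inE eqxx orbT.
have sep x y : x \in [:: a; b; c] -> y \in [:: a; b; c] ->
    (adj x u, adj x v) != (adj y u, adj y v) ->
    exists2 w, w \notin [:: a; b; c] & dist x w != dist y w.
  move=> xs ys; rewrite xpair_eqE negb_and.
  have neq t w : t \in [:: a; b; c] -> w \notin [:: a; b; c] -> (t == w) = false.
    by move=> ts; apply: contraNF => /eqP <-.
  case/orP=> dif; [exists u|exists v] => //.
    rewrite !within2_dist ?diam // !neq //.
    by move: dif; case: (adj x u); case: (adj y u).
  rewrite !within2_dist ?diam // !neq //.
  by move: dif; case: (adj x v); case: (adj y v).
apply: (@gamma_r_delete _ k [:: a; b; c]) => //; last first.
  by move=> x _; exists u => //; apply: within_leq (diam _ _).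
move=> x y xs ys xy; apply: sep => //; move: xs ys xy D.
rewrite !inE /= !inE !negb_or => /or3P[] /eqP -> /or3P[] /eqP ->; rewrite ?eqxx // => _;
by case/and3P=> /andP[] *; rewrite // eq_sym.
Qed.

End Twins.

(** * Classification of the complement *)

Section Classification.
Variable H : sgraph.
Implicit Types a b c d u v w x y z : H.

Hypothesis H_twin : twin_triples H.
(** For the complement of a graph of diameter at most 2 this holds because an edge there joins two
    vertices at distance 2 in the graph; [z] is the middle of a path between them. *)
Hypothesis H_nonadj : forall x y, adj x y ->
  exists z, [/\ z != x, z != y, ~~ adj x z & ~~ adj y z].

Lemma adj_neq x y : adj x y -> x != y.
Proof. by apply: contraTneq => ->; rewrite adj_irr. Qed.

(** Suppose [z] and [w] were adjacent, and let [t] be a common non-neighbour of [y] and [z]. Then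
    [x], [w], [t] have traces 10, 01, 00 on [y], [z], against [H_twin]. *)
Lemma nonadj_path_end x y z w : adj x y -> adj y z -> ~~ adj x z -> x != z ->
  w != x -> w != y -> ~~ adj x w -> ~~ adj y w -> w != z /\ ~~ adj z w.
Proof.
move=> xy yz nxz xz wx wy nxw nyw.
have wz : w != z by apply: contraNneq nyw => ->.
split=> //; apply/negP => zw.
have [t [ty tz nyt nzt]] := H_nonadj yz.
have tx : t != x by apply: contraNneq nyt => ->; rewrite adj_sym.
have tw : t != w by apply: contraNneq nzt => ->.
have yDz := adj_neq yz; have xDy := adj_neq xy.
have := @H_twin x w t y z; rewrite /= !inE !negb_or.
rewrite xDy xz wy wz ty tz yDz (eq_sym x w) wx (eq_sym x t) tx (eq_sym w t) tw /=.
rewrite (adj_sym w y) (adj_sym w z) (adj_sym t y) (adj_sym t z).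
by rewrite xy (negPf nxz) (negPf nyw) zw (negPf nyt) (negPf nzt) => /(_ isT).
Qed.

(** Each of [x], [z], [w] can be completed to a pair on which two vertices of the configuration have
    traces 01 and 00. A neighbour [v] of it would have a trace starting with 1, a third value. *)
Lemma nonadj_star x y z w v : adj x y -> adj y z -> ~~ adj x z -> x != z ->
  w != x -> w != y -> ~~ adj x w -> ~~ adj y w ->
  v != x -> v != y -> v != z -> v != w ->
  [/\ ~~ adj v x, ~~ adj v z & ~~ adj v w].
Proof.
move=> xy yz nxz xz wx wy nxw nyw vx vy vz vw.
have [wz nzw] := nonadj_path_end xy yz nxz xz wx wy nxw nyw.
have yDz := adj_neq yz; have xDy := adj_neq xy.
split; apply/negP => adjv.
- have := @H_twin z v w x y; rewrite /= !inE !negb_or.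
  rewrite xDy wx wy (eq_sym z v) vz (eq_sym z w) wz (eq_sym z x) xz (eq_sym z y) yDz vw vx vy.
  rewrite (adj_sym z x) (adj_sym z y) (adj_sym w x) (adj_sym w y).
  by rewrite (negPf nxz) yz (negPf nxw) (negPf nyw) adjv => /(_ isT).
- have := @H_twin x v w z y; rewrite /= !inE !negb_or.
  rewrite xDy wz wy (eq_sym x v) vz (eq_sym x w) wx (eq_sym z y) xz yDz vw vx vy.
  rewrite (adj_sym w z) (adj_sym w y).
  by rewrite (negPf nxz) xy (negPf nzw) (negPf nyw) adjv => /(_ isT).
have := @H_twin y z v w x; rewrite /= !inE !negb_or.
rewrite yDz (eq_sym y v) vy (eq_sym y w) wy (eq_sym y x) xDy (eq_sym z v) vz.
rewrite (eq_sym z w) wz (eq_sym z x) xz vw vx wx.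
rewrite (adj_sym y x) (adj_sym z x).
by rewrite xy (negPf nxz) (negPf nyw) (negPf nzw) adjv => /(_ isT).
Qed.

(** An edge [u v] avoiding [y] must avoid [x], [z], [w] too, and neither of its ends is adjacent to
    [y]. Then [x], [v], [w] have traces 01, 10, 00 on [u], [y], a contradiction. *)
Lemma star_center x y z w u v : adj x y -> adj y z -> ~~ adj x z -> x != z ->
  w != x -> w != y -> ~~ adj x w -> ~~ adj y w -> adj u v -> u = y \/ v = y.
Proof.
move=> xy yz nxz xz wx wy nxw nyw.
have [wz nzw] := nonadj_path_end xy yz nxz xz wx wy nxw nyw.
have star := nonadj_star xy yz nxz xz wx wy nxw nyw.
have out a b : adj a b -> b != y -> [/\ a != x, a != z & a != w].
  move=> ab by_; have [bx|bx] := eqVneq b x.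
    subst b; split; apply: contraTneq ab => ->; rewrite ?adj_irr // adj_sym //.
  have [bz|bz] := eqVneq b z.
    by subst b; split; apply: contraTneq ab => ->; rewrite ?adj_irr // adj_sym.
  have [bw|bw] := eqVneq b w.
    by subst b; split; apply: contraTneq ab => ->; rewrite ?adj_irr.
  have [nbx nbz nbw] := star b bx by_ bz bw.
  by split; apply: contraTneq ab => ->; rewrite adj_sym.
move=> uv; have [->|uy] := eqVneq u y; first by left.
have [->|vy] := eqVneq v y; [by right|exfalso].
have [ux uz uw] := out u v uv vy.
have vu : adj v u by rewrite adj_sym.
have [vx vz vw] := out v u vu uy.
have uDv := adj_neq uv.
(* If [a] were adjacent to [y], then [a y z] would be another induced path missed by [w], and
   [nonadj_star] applied to it would forbid the edge [a b]. *)
have noy a b : adj a b -> a != b -> a != y -> a != x -> a != z -> a != w ->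
    b != y -> b != x -> b != z -> b != w -> ~~ adj a y.
  move=> ab aDb ay ax az aw by_ bx bz bw; apply/negP => a_y.
  have [nax naz naw] := star a ax ay az aw.
  have wa : w != a by rewrite eq_sym.
  have ba : b != a by rewrite eq_sym.
  have [nba _ _] := nonadj_star a_y yz naz az wa wy naw nyw ba by_ bz bw.
  by rewrite adj_sym ab in nba.
have nuy := noy u v uv uDv uy ux uz uw vy vx vz vw.
have nvy : ~~ adj v y by apply: (noy v u) => //; rewrite eq_sym.
have [nux _ nuw] := star u ux uy uz uw.
have := @H_twin x v w u y; rewrite /= !inE !negb_or.
rewrite (eq_sym x v) vx (eq_sym x w) wx (eq_sym x u) ux (adj_neq xy) vw (eq_sym v u) uDv vy.
rewrite (eq_sym w u) uw wy uy (adj_sym x u) (adj_sym v u) (adj_sym w u) (adj_sym w y).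
by rewrite (negPf nux) xy uv (negPf nvy) (negPf nuw) (negPf nyw) => /(_ isT).
Qed.

(** The three outcomes are a star with isolated vertices, two disjoint cliques, and one clique with
    isolated vertices. *)
Lemma twin_classification a b : adj a b ->
  [\/ exists c, (forall u v, adj u v -> u = c \/ v = c) /\
        (exists x, adj c x) /\ exists2 w, w != c & ~~ adj c w,
      exists P : {set H}, [/\ 0 < #|P|, 0 < #|~: P|
        & forall x y, adj x y = (x != y) && ((x \in P) == (y \in P))]
    | exists P : {set H}, [/\ 1 < #|P|, 0 < #|~: P|
        & forall x y, adj x y = [&& x != y, x \in P & y \in P]]].
Proof.
move=> ab.
have [/existsP[[[x y] z] /= /and4P[xy yz nxz xz]]|noP3] :=
  boolP [exists t : H * H * H,
    [&& adj t.1.1 t.1.2, adj t.1.2 t.2, ~~ adj t.1.1 t.2 & t.1.1 != t.2]].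
  have [w [wx wy nxw nyw]] := H_nonadj xy.
  apply: Or31; exists y; split; last by split; [exists z|exists w].
  by move=> u v; apply: star_center xy yz nxz xz wx wy nxw nyw.
(* Without an induced path on three vertices, components are cliques; [P] below is the component of
   [a]. *)
have tr x y z : adj x y -> adj y z -> x != z -> adj x z.
  move=> xy yz xz; apply: contraNT noP3 => nxz; apply/existsP.
  by exists (x, y, z); rewrite /= xy yz nxz xz.
pose P := [set v | (v == a) || adj a v].
have aP : a \in P by rewrite inE eqxx.
have bP : b \in P by rewrite inE ab orbT.
have cliqueP x y : x \in P -> y \in P -> x != y -> adj x y.
  rewrite !inE => /predU1P[->|ax] /predU1P[->|ay] xy; rewrite ?eqxx // in xy *.
    by rewrite adj_sym.
  by rewrite adj_sym in ax; apply: tr ax ay xy.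
have closedP x y : x \in P -> adj x y -> y \in P.
  rewrite !inE => /predU1P[->->|ax xy]; first by rewrite orbT.
  by have [//|ya] := eqVneq y a; apply: tr ax xy _; rewrite eq_sym.
have P2 : 1 < #|P| by apply/card_gt1P; exists a, b; split=> //; apply: adj_neq.
have CP0 : 0 < #|~: P|.
  have [w [wa wb naw _]] := H_nonadj ab.
  by apply/card_gt0P; exists w; rewrite !inE negb_or wa.
have [/existsP[[c d] /= /and3P[cP dP cd]]|noC] :=
  boolP [exists t : H * H, [&& t.1 \notin P, t.2 \notin P & adj t.1 t.2]].
  have inC e : e \notin P -> e != c -> adj e c.
    move=> eP ec; apply: contraT => nec.
    have ned : ~~ adj e d.
      by apply: contra nec => ed; rewrite adj_sym in cd; apply: tr ed cd ec.
    have nPd x y : x \in P -> y \notin P ->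
        (x == y = false) * (adj x y = false) * (adj y x = false).
      move=> xP yP; rewrite [adj y x]adj_sym; split; first split.
      - by apply: contraNF yP => /eqP <-.
      - by apply: contraNF yP; apply: closedP.
      - by apply: contraNF yP; apply: closedP.
    have de : d != e by apply: contraNneq nec => <-; rewrite adj_sym.
    (* A third component containing [e] would give [a], [c], [e] the traces 10, 01, 00 on [b],
       [d]. *)
    have := @H_twin a c e b d; rewrite /= !inE !negb_or.
    rewrite (eq_sym c e) (eq_sym c b) (eq_sym e b) (eq_sym e d) ec de.
    rewrite !(nPd a c, nPd a d, nPd a e, nPd b c, nPd b d, nPd b e) //.
    by rewrite ab cd (negPf ned) (adj_neq ab) (adj_neq cd) => /(_ isT).
  apply: Or32; exists P; split=> //; first exact: ltnW.
  move=> x y; have [->|xy] := eqVneq x y; first by rewrite adj_irr.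
  have [xP|xP] := boolP (x \in P); have [yP|yP] := boolP (y \in P) => /=.
  - exact: cliqueP.
  - by apply: contraNF yP; apply: closedP.
  - by apply: contraNF xP; rewrite adj_sym; apply: closedP.
  have [xc|xc] := eqVneq x c; first by rewrite xc adj_sym inC // -xc eq_sym.
  have [->|yc] := eqVneq y c; first exact: inC.
  by apply: (tr x c) => //; [|rewrite adj_sym]; apply: inC.
apply: Or33; exists P; split=> // x y; have [->|xy] := eqVneq x y; first by rewrite adj_irr.
have [xP|xP] := boolP (x \in P); have [yP|yP] := boolP (y \in P) => /=.
- exact: cliqueP.
- by apply: contraNF yP; apply: closedP.
- by apply: contraNF xP; rewrite adj_sym; apply: closedP.
by apply: contraNF noC => adjxy; apply/existsP; exists (x, y); rewrite /= xP yP.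
Qed.

End Classification.

(** * The three families, and the value n - 2 in part (b) *)

Section Families.
Variable G : sgraph.
Implicit Types (u v w x y z : G) (P Q : {set G}).

Definition bipartition P := [/\ 0 < #|P|, 0 < #|~: P|
  & forall x y, adj x y = ((x \in P) != (y \in P))].

(** Intrinsic form of the join of a clique and an independent set: [P] is the independent set. *)
Definition split_partition P := [/\ 1 < #|P|, 0 < #|~: P|
  & forall x y, adj x y = (x != y) && ~~ ((x \in P) && (y \in P))].

(** Here [c] is the isolated vertex of the union and [Q] its other clique. The edges of the
    complement form a star with centre [c] and leaves [Q]. *)
Definition star_partition c Q := [/\ c \notin Q, 0 < #|Q|, 0 < #|~: (c |: Q)|
  & forall x y, adj x y =
      (x != y) && ~~ ((x == c) && (y \in Q) || (y == c) && (x \in Q))].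

(** Maps out of a model graph are easy to define by cases on the sum type; the isomorphism from [G]
    is obtained by choosing preimages. *)
Lemma iso_onto (A : sgraph) (g : A -> G) : injective g ->
  (forall x, exists a, x = g a) -> (forall a b, adj (g a) (g b) = adj a b) -> iso G A.
Proof.
move=> ginj gsurj gadj.
have gex x : exists a, g a == x by have [a ->] := gsurj x; exists a.
have gK x : g (xchoose (gex x)) = x by apply/eqP/(xchooseP (gex x)).
exists (fun x => xchoose (gex x)); last by move=> x y; rewrite -gadj !gK.
by exists g => [x|a]; [exact: gK|apply: ginj; rewrite gK].
Qed.

Lemma enum_val_onto (P : {set G}) x : x \in P -> exists i : 'I_#|P|, x = enum_val i.
Proof. by move=> xP; exists (enum_rank_in xP x); rewrite enum_rankK_in. Qed.

Lemma iso_bipartiteP :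
  (exists s t, 1 <= s /\ 1 <= t /\ iso G (complete_bipartite s t)) <->
  exists P, bipartition P.
Proof.
split=> [[s [t [s0 [t0 [f fbij fadj]]]]]|[P [P0 CP0 Padj]]].
  case: (fbij) => g fg gf.
  exists [set x | if f x is inl _ then true else false]; split.
  - by apply/card_gt0P; exists (g (inl (Ordinal s0))); rewrite inE gf.
  - by apply/card_gt0P; exists (g (inr (Ordinal t0))); rewrite !inE gf.
  by move=> x y; rewrite !inE -fadj; case: (f x) (f y) => [?|?] [?|?].
exists #|P|, #|~: P|; split=> //; split=> //.
have PE (i : 'I_#|P|) : enum_val i \in P by apply: enum_valP.
have CPE (i : 'I_#|~: P|) : enum_val i \in P = false.
  by apply: negPf; have := enum_valP i; rewrite inE.
pose g (a : complete_bipartite #|P| #|~: P|) : G :=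
  match a with inl i => enum_val i | inr j => enum_val j end.
apply: (@iso_onto _ g).
- move=> [i|i] [j|j] /= E; try by rewrite (enum_val_inj E).
    by have := PE i; rewrite E CPE.
  by have := PE j; rewrite -E CPE.
- move=> x; have [/enum_val_onto[i ->]|xP] := boolP (x \in P); first by exists (inl i).
  have /enum_val_onto[i ->] : x \in ~: P by rewrite inE.
  by exists (inr i).
by move=> [i|i] [j|j]; rewrite Padj /= ?PE ?CPE.
Qed.

Lemma iso_splitP :
  (exists s t, 1 <= s /\ 2 <= t /\
     iso G (join_graph (complete s) (compl_graph (complete t)))) <->
  exists P, split_partition P.
Proof.
split=> [[s [t [s0 [t1 [f fbij fadj]]]]]|[P [P1 CP0 Padj]]].
  case: (fbij) => g fg gf.
  exists [set x | if f x is inr _ then true else false]; split.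
  - apply/card_gt1P; exists (g (inr (Ordinal (ltnW t1)))), (g (inr (Ordinal t1))).
    by rewrite !inE !gf (inj_eq (can_inj gf)).
  - by apply/card_gt0P; exists (g (inl (Ordinal s0))); rewrite !inE gf.
  move=> x y; rewrite !inE -fadj -(inj_eq (bij_inj fbij)).
  case: (f x) (f y) => [i|i] [j|j] //=; rewrite ?andbT //.
  by rewrite /compl_rel /= /complete_rel andbN andbF.
exists #|~: P|, #|P|; split=> //; split=> //.
have PE (i : 'I_#|P|) : enum_val i \in P by apply: enum_valP.
have CPE (i : 'I_#|~: P|) : enum_val i \in P = false.
  by apply: negPf; have := enum_valP i; rewrite inE.
pose g (a : join_graph (complete #|~: P|) (compl_graph (complete #|P|))) : G :=
  match a with inl i => enum_val i | inr j => enum_val j end.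
have ginj : injective g.
  move=> [i|i] [j|j] /= E; try by rewrite (enum_val_inj E).
    by have := PE j; rewrite -E CPE.
  by have := PE i; rewrite E CPE.
apply: (iso_onto ginj).
  move=> x; have [/enum_val_onto[i ->]|xP] := boolP (x \in P); first by exists (inr i).
  have /enum_val_onto[i ->] : x \in ~: P by rewrite inE.
  by exists (inl i).
move=> a b; rewrite Padj (inj_eq ginj).
case: a b => [i|i] [j|j]; rewrite /= ?PE ?CPE ?andbT //.
by rewrite /compl_rel /= /complete_rel andbN andbF.
Qed.

Lemma iso_starP :
  (exists s t, 1 <= s /\ 1 <= t /\
     iso G (join_graph (complete s) (union_graph (complete 1) (complete t)))) <->
  exists c Q, star_partition c Q.
Proof.
split=> [[s [t [s0 [t0 [f fbij fadj]]]]]|[c [Q [cQ Q0 CQ0 Qadj]]]].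
  case: (fbij) => g fg gf.
  exists (g (inr (inl ord0))), [set x | if f x is inr (inr _) then true else false].
  split.
  - by rewrite inE gf.
  - by apply/card_gt0P; exists (g (inr (inr (Ordinal t0)))); rewrite inE gf.
  - apply/card_gt0P; exists (g (inl (Ordinal s0))).
    by rewrite !inE gf (inj_eq (can_inj gf)).
  move=> x y; rewrite !inE -fadj -(inj_eq (bij_inj fbij)).
  rewrite -!(inj_eq (bij_inj fbij) _ (g _)) gf.
  by case: (f x) (f y) => [i|[i|i]] [j|[j|j]]; rewrite /= ?andbT //= ?(ord1 i) ?(ord1 j).
exists #|~: (c |: Q)|, #|Q|; split=> //; split=> //.
have QE (i : 'I_#|Q|) : enum_val i \in Q by apply: enum_valP.
have QEc (i : 'I_#|Q|) : enum_val i == c = false.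
  by apply: contraNF cQ => /eqP <-.
have CE (i : 'I_#|~: (c |: Q)|) : (enum_val i == c = false) * (enum_val i \in Q = false).
  by have := enum_valP i; rewrite !inE negb_or => /andP[/negPf -> /negPf ->].
pose g (a : join_graph (complete #|~: (c |: Q)|)
    (union_graph (complete 1) (complete #|Q|))) : G :=
  match a with inl i => enum_val i | inr (inl _) => c | inr (inr j) => enum_val j end.
have ginj : injective g.
  move=> [i|[i|i]] [j|[j|j]] /= E; try by rewrite (enum_val_inj E).
  - by have := CE i; rewrite E eqxx => -[].
  - by have := CE i; rewrite E QE => -[].
  - by have := CE j; rewrite -E eqxx => -[].
  - by rewrite (ord1 i) (ord1 j).
  - by have := QEc j; rewrite -E eqxx.
  - by have := CE j; rewrite -E QE => -[].
  - by have := QEc i; rewrite E eqxx.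
apply: (iso_onto ginj).
  move=> x; have [->|xc] := eqVneq x c; first by exists (inr (inl ord0)).
  have [/enum_val_onto[i ->]|xQ] := boolP (x \in Q); first by exists (inr (inr i)).
  have /enum_val_onto[i ->] : x \in ~: (c |: Q) by rewrite !inE negb_or xc.
  by exists (inl i).
move=> a b; rewrite Qadj (inj_eq ginj).
by case: a b => [i|[i|i]] [j|[j|j]];
  rewrite /= ?QE ?QEc ?CE ?eqxx ?(negPf cQ) ?andbT //= ?(ord1 i) ?(ord1 j).
Qed.

Lemma within2_common x y z : adj x z -> adj z y -> within 2 x y.
Proof.
by move=> xz zy; apply/withinP; exists 2 => //; apply/walkS; exists z; rewrite ?walk1.
Qed.

(** If three vertices were missing from a resolving [D], two of them would have the same neighbours
    outside the triple, hence in [D]; with diameter at most 2 they would have the same distances to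
    [D]. *)
Lemma gamma_r_twin k x0 y0 : connected G -> 1 < k -> x0 != y0 -> ~~ adj x0 y0 ->
  (forall x y, within 2 x y) ->
  (forall a b c, uniq [:: a; b; c] -> exists x y,
     [/\ x \in [:: a; b; c], y \in [:: a; b; c], x != y
       & forall w, w \notin [:: a; b; c] -> adj x w = adj y w]) ->
  gamma_r k G = #|G| - 2.
Proof.
move=> cG k2 xy nxy diam twin; apply/eqP.
rewrite eqn_leq (gamma_r_not_complete cG k2 xy nxy) /=.
have [D [/resolvingP res _ <-]] := gamma_r_ex G k.
rewrite leq_subLR -(cardsC D) addnC leq_add2r leqNgt; apply/negP => D3.
have /card_gt2P[a [b [c [[aD bD cD] [ab bc ca]]]]] := D3.
have abc : uniq [:: a; b; c] by rewrite /= !inE negb_or ab bc eq_sym ca.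
have sub x : x \in [:: a; b; c] -> x \notin D.
  by rewrite !inE in aD bD cD *; case/or3P => /eqP ->.
have [x [y [xs ys xDy eqa]]] := twin _ _ _ abc.
have [w wD] := res x y (sub x xs) (sub y ys) xDy.
have ws : w \notin [:: a; b; c] by apply: contraL wD; apply: sub.
have neq t : t \in [:: a; b; c] -> (t == w) = false by move=> ts; apply: contraNF ws => /eqP <-.
by rewrite !within2_dist ?diam // !neq // eqa // eqxx.
Qed.

Lemma gamma_r_bipartition k P : connected G -> 1 < k -> 3 <= #|G| ->
  bipartition P -> gamma_r k G = #|G| - 2.
Proof.
move=> cG k2 G3 [/card_gt0P[p pP] /card_gt0P[q]]; rewrite inE => qP Padj.
(* With at least three vertices, one side contains two, which are then non-adjacent. *)
have [x [y [xy Pxy]]] : exists x y, x != y /\ (x \in P) = (y \in P).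
  have : (1 < #|P|) || (1 < #|~: P|) by move: G3; rewrite -(cardsC P); lia.
  case/orP=> /card_gt1P[x [y [xP yP xy]]]; exists x, y; split=> //; first by rewrite xP yP.
  by move: xP yP; rewrite !inE => /negPf -> /negPf ->.
apply: (gamma_r_twin cG k2 xy) => [|u v|a b c]; first by rewrite Padj Pxy eqxx.
  have [uv|uv] := boolP ((u \in P) != (v \in P)).
    by apply: adj_within; rewrite ?Padj.
  move: uv; rewrite negbK => /eqP uv.
  by have [uP|uP] := boolP (u \in P);
    [apply: (@within2_common _ _ q)|apply: (@within2_common _ _ p)];
    rewrite !Padj -?uv ?(negPf uP) ?(negPf qP) ?pP ?uP.
rewrite /= !inE negb_or andbT => /andP[/andP[ab ac] bc].
have pair u v : (u \in P) = (v \in P) -> forall w, w \notin [:: a; b; c] -> adj u w = adj v w.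
  by move=> uv w _; rewrite !Padj uv.
have [Pab|Pab] := eqVneq (a \in P) (b \in P).
  by exists a, b; split=> //; rewrite ?inE ?eqxx ?orbT //; apply: pair.
have [Pac|Pac] := eqVneq (a \in P) (c \in P).
  by exists a, c; split=> //; rewrite ?inE ?eqxx ?orbT //; apply: pair.
exists b, c; split=> //; rewrite ?inE ?eqxx ?orbT //; apply: pair.
by move: Pab Pac; case: (a \in P) (b \in P) (c \in P) => [] [] [].
Qed.

Lemma gamma_r_split_partition k P : connected G -> 1 < k ->
  split_partition P -> gamma_r k G = #|G| - 2.
Proof.
move=> cG k2 [/card_gt1P[x [y [xP yP xy]]] /card_gt0P[q]]; rewrite inE => qP Padj.
apply: (gamma_r_twin cG k2 xy) => [|u v|a b c]; first by rewrite Padj xP yP andbF.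
  have [->|uq] := eqVneq u q; have [->|vq] := eqVneq v q.
  - by apply/withinP; exists 0; rewrite ?walk0.
  - by apply: adj_within; rewrite // Padj eq_sym vq (negPf qP).
  - by apply: adj_within; rewrite // Padj uq (negPf qP) andbF.
  by apply: (@within2_common _ _ q); rewrite Padj ?uq ?(eq_sym q v) ?vq (negPf qP) ?andbF.
rewrite /= !inE negb_or andbT => /andP[/andP[ab ac] bc].
have pair u v : u \in [:: a; b; c] -> v \in [:: a; b; c] -> (u \in P) = (v \in P) ->
    forall w, w \notin [:: a; b; c] -> adj u w = adj v w.
  move=> us vs uv w ws; rewrite !Padj uv.
  have neq t : t \in [:: a; b; c] -> (t == w) = false by move=> ts; apply: contraNF ws => /eqP <-.
  by rewrite !neq.
have [Pab|Pab] := eqVneq (a \in P) (b \in P).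
  by exists a, b; split=> //; rewrite ?inE ?eqxx ?orbT //; apply: pair; rewrite ?inE ?eqxx ?orbT.
have [Pac|Pac] := eqVneq (a \in P) (c \in P).
  by exists a, c; split=> //; rewrite ?inE ?eqxx ?orbT //; apply: pair; rewrite ?inE ?eqxx ?orbT.
exists b, c; split=> //; rewrite ?inE ?eqxx ?orbT //; apply: pair; rewrite ?inE ?eqxx ?orbT //.
by move: Pab Pac; case: (a \in P) (b \in P) (c \in P) => [] [] [].
Qed.

(** A vertex [q] outside [c] and [Q] is adjacent to all others, so the diameter is at most 2. If a
    triple contains [c], its other two vertices agree outside the triple; otherwise two of its
    vertices agree on membership in [Q]. *)
Lemma gamma_r_star_partition k c Q : connected G -> 1 < k ->
  star_partition c Q -> gamma_r k G = #|G| - 2.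
Proof.
move=> cG k2 [cQ /card_gt0P[x xQ] /card_gt0P[q]]; rewrite !inE negb_or => /andP[qc qQ] Qadj.
have cx : c != x by apply: contraNneq cQ => ->.
apply: (gamma_r_twin cG k2 cx) => [|u v|a1 a2 a3]; first by rewrite Qadj xQ eqxx andbF.
  have adjq t : t != q -> adj t q by move=> tq; rewrite Qadj tq (negPf qQ) (negPf qc) !andbF.
  have [->|uq] := eqVneq u q; have [->|vq] := eqVneq v q.
  - by apply/withinP; exists 0; rewrite ?walk0.
  - by apply: adj_within; rewrite // adj_sym adjq.
  - by apply: adj_within; rewrite // adjq.
  by apply: (@within2_common _ _ q); [|rewrite adj_sym]; apply: adjq.
move=> U; pose s := [:: a1; a2; a3].
suff [u [v [us vs uv E]]] : exists u v, [/\ u \in s, v \in s, u != v &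
    ((u == c) = (v == c)) /\ ((u \in Q) = (v \in Q)) \/ c \in s /\ u != c /\ v != c].
  exists u, v; split=> // w ws.
  have neq t : t \in s -> (t == w) = false by move=> ts; apply: contraNF ws => /eqP <-.
  rewrite !Qadj !neq //; case: E => [[-> ->] //|[cs [/negPf -> /negPf ->]]].
  by rewrite (eq_sym w c) neq.
move: U; rewrite /= !inE negb_or andbT => /andP[/andP[a12 a13] a23].
have [E1|n1] := eqVneq a1 c.
  exists a2, a3; split; rewrite ?inE ?eqxx ?orbT //; right.
  by rewrite -E1 !(eq_sym _ a1).
have [E2|n2] := eqVneq a2 c.
  exists a1, a3; split; rewrite ?inE ?eqxx ?orbT //; right.
  by rewrite -E2 ?orbT (eq_sym a3).
have [E3|n3] := eqVneq a3 c.
  exists a1, a2; split; rewrite ?inE ?eqxx ?orbT //; right.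
  by rewrite -E3 ?orbT.
have [Q12|Q12] := eqVneq (a1 \in Q) (a2 \in Q).
  by exists a1, a2; split; rewrite ?inE ?eqxx ?orbT //; left; rewrite (negPf n1) (negPf n2).
have [Q13|Q13] := eqVneq (a1 \in Q) (a3 \in Q).
  by exists a1, a3; split; rewrite ?inE ?eqxx ?orbT //; left; rewrite (negPf n1) (negPf n3).
exists a2, a3; split; rewrite ?inE ?eqxx ?orbT //; left; rewrite (negPf n2) (negPf n3).
by move: Q12 Q13; case: (a1 \in Q) (a2 \in Q) (a3 \in Q) => [] [] [].
Qed.

Lemma gamma_r_diam2_classification k : connected G -> 1 < k -> 4 <= #|G| ->
  (forall x y, within 2 x y) -> gamma_r k G = #|G| - 2 ->
  [\/ exists P, bipartition P, exists P, split_partition P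
    | exists c Q, star_partition c Q].
Proof.
move=> cG k2 G4 diam gG.
have T : twin_triples (compl_graph G).
  (* On four vertices the condition is vacuous, as it speaks of five distinct ones. *)
  apply: twin_triples_compl; have [G5|G5] := leqP 5 #|G|; first exact: twin_triples_gamma_r gG.
  move=> a b c u v U; have := max_card (mem [:: a; b; c; u; v]).
  by rewrite (card_uniqP U) leqNgt G5.
have nonadj (x y : compl_graph G) : adj x y ->
    exists z : compl_graph G, [/\ z != x, z != y, ~~ adj x z & ~~ adj y z].
  rewrite /= /compl_rel => /andP[xy nxy].
  have := within2_dist (diam x y); rewrite (negPf xy) (negPf nxy).
  case/dist_SomeS=> z xz /dist_Some1 zy; exists z.
  have yz : adj (y : G) z by rewrite adj_sym.
  by rewrite /= /compl_rel eq_sym (adj_neq xz) (adj_neq zy) xz yz !andbF.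
have Gadj (x y : G) : adj x y = (x != y) && ~~ @adj (compl_graph G) x y.
  rewrite /= /compl_rel negb_and negbK; have [->|_] := eqVneq x y; last by rewrite negbK.
  by rewrite adj_irr.
(* If the complement has no edge, [G] is complete and the value would be n - 1. *)
have [[x y] /= xy|noadj] := pickP (fun t : G * G => @adj (compl_graph G) t.1 t.2); last first.
  have [_ gE] := gamma_r_completeP cG (ltnW (ltnW G4)) k2.
  have : gamma_r k G = #|G| - 1.
    by apply: gE; apply/iso_completeP => // u v; rewrite Gadj (noadj (u, v)) andbT.
  by rewrite gG; lia.
case: (twin_classification T nonadj xy)
  => [[c [ctr [[x' cx'] [w wc ncw]]]]|[P [P0 CP0 Padj]]|[P [P1 CP0 Padj]]].
- apply: Or33; exists c, [set v | @adj (compl_graph G) c v]; split.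
  + by rewrite inE adj_irr.
  + by apply/card_gt0P; exists x'; rewrite inE.
  + by apply/card_gt0P; exists w; rewrite !inE negb_or wc.
  move=> u v; rewrite Gadj !inE; congr (_ && ~~ _).
  apply/idP/orP => [uv|[/andP[/eqP -> //]|/andP[/eqP ->]]]; last by rewrite adj_sym.
  case: (ctr u v uv) => E; subst; [left|right]; rewrite eqxx //.
  by rewrite adj_sym.
- apply: Or31; exists P; split=> // u v; rewrite Gadj Padj.
  by have [->|] := eqVneq u v; rewrite ?eqxx.
apply: Or32; exists P; split=> // u v; rewrite Gadj Padj.
by have [->|] := eqVneq u v.
Qed.

Lemma gamma_r_families k : connected G -> 1 < k -> 4 <= #|G| ->
  (exists P, bipartition P) \/ (exists P, split_partition P) \/
    (exists c Q, star_partition c Q) -> gamma_r k G = #|G| - 2.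
Proof.
move=> cG k2 G4 [[P PP]|[[P PP]|[c [Q QQ]]]].
- by apply: gamma_r_bipartition PP => //; apply: ltnW.
- exact: gamma_r_split_partition PP.
exact: gamma_r_star_partition QQ.
Qed.

(** When some distance exceeds 2, three deletions are possible as soon as there are five vertices.
    On four vertices the value for every [k] above 2 is 1, so [k = 2], and the value 1 at [k = 3]
    shows that [G] is a path. *)
Lemma gamma_r_card_sub2 k : connected G -> 1 < k -> 4 <= #|G| ->
  gamma_r k G = #|G| - 2 ->
  [/\ #|G| = 4, iso G (path_graph 4) & k = 2] \/
  ((exists P, bipartition P) \/ (exists P, split_partition P) \/
    (exists c Q, star_partition c Q)).
Proof.
move=> cG k2 G4 gG.
have [diam|/forallPn[x /forallPn[y nxy]]] := boolP [forall x : G, forall y : G, within 2 x y].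
  right; case: (gamma_r_diam2_classification cG k2 G4 _ gG) => [x y|?|?|?].
  - by have /forallP/(_ x)/forallP := diam.
  - by left.
  - by right; left.
  - by right; right.
left; have [G5|G4'] := leqP 5 #|G|; first by have := gamma_r_diam3 cG k2 G5 nxy; lia.
have {G4'}G4 : #|G| = 4 by lia.
have g3 k' (k3 : 2 < k') := gamma_r_diam3_card4 cG k3 G4 nxy.
split=> //; first by have [_] := gamma_r_eq1_iso_path (g3 3 isT); rewrite G4.
by apply/eqP; rewrite eqn_leq k2 andbT leqNgt; apply/negP => /g3; rewrite gG G4.
Qed.

Lemma gamma_r_path4 : connected G -> iso G (path_graph 4) -> gamma_r 2 G = #|G| - 2.
Proof.
move=> cG isoG; have G4 : #|G| = 4 by rewrite (iso_card isoG) card_ord.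
case: (isoG) => f [g fg gf] fadj.
pose i0 : 'I_4 := @Ordinal 4 0 isT; pose i2 : 'I_4 := @Ordinal 4 2 isT.
have le2 : gamma_r 2 G <= #|G| - 2.
  apply: (@gamma_r_not_complete _ 2 (g i0) (g i2)) => //.
    by rewrite (inj_eq (can_inj gf)).
  by rewrite -fadj !gf.
have : gamma_r 2 G != 1.
  (* The value 1 for [k = 2] would allow at most three vertices. *)
  apply/eqP => /gamma_r_eq1_iso_path[]; rewrite G4 //.
have : 0 < gamma_r 2 G by apply: gamma_r_gt0; rewrite G4.
by move: le2; rewrite G4; lia.
Qed.

End Families.

(** * Assembly of the three parts *)

Theorem theorem3p2 (G : sgraph) (n : nat) (hn : #|G| = n) (hn2 : 2 <= n) :
  (forall k : nat, 1 <= k ->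
     (gamma_r k G = 1 <->
      exists m : nat, 2 <= m <= k.+1 /\ iso G (path_graph m)))
  /\
  (connected G -> 4 <= n ->
     (gamma_r 2 G = n - 2 <->
        iso G (path_graph 4)
        \/ (exists s t : nat, 1 <= s /\ 1 <= t /\ iso G (complete_bipartite s t))
        \/ (exists s t : nat, 1 <= s /\ 2 <= t /\
              iso G (join_graph (complete s) (compl_graph (complete t))))
        \/ (exists s t : nat, 1 <= s /\ 1 <= t /\
              iso G (join_graph (complete s)
                       (union_graph (complete 1) (complete t)))))
     /\
     (forall k : nat, 3 <= k ->
       (gamma_r k G = n - 2 <->
          (exists s t : nat, 1 <= s /\ 1 <= t /\ iso G (complete_bipartite s t))
          \/ (exists s t : nat, 1 <= s /\ 2 <= t /\
                iso G (join_graph (complete s) (compl_graph (complete t))))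
          \/ (exists s t : nat, 1 <= s /\ 1 <= t /\
                iso G (join_graph (complete s)
                         (union_graph (complete 1) (complete t)))))))
  /\
  (connected G -> forall k : nat, 2 <= k ->
     (gamma_r k G = n - 1 <-> iso G (complete n))).
Proof.
subst n; split; [|split].
- by move=> k k0; apply: gamma_r_eq1P.
- move=> cG G4; split=> [|k k3]; rewrite iso_bipartiteP iso_splitP iso_starP.
    split=> [/(gamma_r_card_sub2 cG (ltnSn 1) G4)[[_ P4 _]|fam]|[P4|fam]]; [by left|by right| |].
      exact: gamma_r_path4.
    exact: gamma_r_families.
  have k2 : 1 < k by apply: ltnW.
  (* The path on four vertices occurs only for [k = 2]. *)
  split=> [/(gamma_r_card_sub2 cG k2 G4)[[_ _ kE]|//]|]; first by rewrite kE in k3.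
  exact: gamma_r_families.
by move=> cG k k2; apply: gamma_r_completeP.
Qed.
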